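(* Let $(a,b)$ be $\left(\frac{19}{25},\frac{89}{100}\right)$ or $\left(\frac34,\frac{19}{20}\right)$. Let $R,B$ be two triangle-free graphs on the same vertex set of size $n$ with $|R|+|B|\ge b\,n^2/2$. Then $|R\cup B|\le a\,n^2/2+o(n^2)$. (That is, for every $\varepsilon>0$ there is $n_0$ such that for all $n\ge n_0$ and all such $R,B$ on $n$ vertices, $|R\cup B|\le a\,n^2/2+\varepsilon n^2$.)
   Context: For a graph $H$, $|H|$ denotes its number of edges. $R\cup B$ is the simple graph on the common vertex set whose edges are the pairs lying in at least one of $R$, $B$ (the edge sets of $R$ and $B$ may overlap). *)

(* Defs.v *)
From mathcomp Require Import all_boot all_order all_algebra.
From mathcomp Require Import reals.

Set Implicit Arguments.
Unset Strict Implicit.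
Unset Printing Implicit Defensive.

Record sgraph (V : finType) := SGraph {
  adj : rel V;
  adj_sym : symmetric adj;
  adj_irr : irreflexive adj
}.

Definition edges (V : finType) (H : sgraph V) : {set {set V}} :=
  [set [set p.1; p.2] | p : V * V & adj H p.1 p.2].

Definition triangle_free (V : finType) (H : sgraph V) : Prop :=
  forall x y z : V, ~ [/\ adj H x y, adj H y z & adj H x z].

Section Union.
Variables (V : finType) (G H : sgraph V).

Definition union_adj : rel V := fun x y => adj G x y || adj H x y.

Lemma union_adj_sym : symmetric union_adj.
Proof. by move=> x y; rewrite /union_adj adj_sym [adj H x y]adj_sym. Qed.

Lemma union_adj_irr : irreflexive union_adj.
Proof. by move=> x; rewrite /union_adj !adj_irr. Qed.

Definition gunion : sgraph V := SGraph union_adj_sym union_adj_irr.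
End Union.

(* Main.v *)
Require Import Defs.
From mathcomp Require Import all_boot all_order all_algebra.
From mathcomp Require Import reals.
From mathcomp Require Import zify ring lra.
Import Order.TTheory GRing.Theory Num.Theory.
Local Open Scope ring_scope.

(** The bound holds exactly, for every [n] and with no error term.  Write [m]
    for the size of a vertex set [A], and let [u] and [s] count the ordered
    pairs inside [A] that are adjacent in the union, respectively adjacent in
    [R] plus adjacent in [B].

    If the union has no 5-clique on [A], Turan gives [u <= 3/4 m^2] and Mantel,
    applied to each colour, gives [s <= m^2].  Otherwise a 5-clique [Q] is
    deleted.  A vertex has at most two neighbours of each colour in a clique
    of the union (three of them would span a triangle of the other colour), so
    the degrees in [R] and in [B] of the vertices of [Q] sum to at most [4m]:
    when [s >= 4/5 m^2], as it is here,
    deletion does not lower the density of [s].  Their degrees in the union sum to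
    at most [3m + w], where [w] counts the vertices joined to four
    vertices of [Q].

    What has to be shown is that [w] is well below [m].  Two vertices joined
    in both colours have at most two common neighbours in [Q], whereas two
    vertices with four neighbours each share three of them; hence the [w]
    vertices span no bicoloured edge ([full_no_bicoloured]).  A large set
    without bicoloured edges makes [s] small:
    [s + 14/25 m w <= 34/25 m^2] ([sparse_pairs]).  This is a Motzkin-Straus
    argument: the left-hand side is the value at the uniform weights of a
    quadratic form that can be increased until the weights live on a clique of
    the union ([clique_weights]); such a clique has at most five vertices and
    its bicoloured edges form a matching, so that the form can be bounded by
    hand ([sparse_weights]).

    For [s >= 19/20 m^2] this gives [w <= 3/4 m], and [u <= 3/4 m^2] follows by
    induction.  For [s >= 89/100 m^2] it gives [w <= 47/56 m], which is not
    enough to keep [u <= 19/25 m^2] through the induction; but the stronger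
    [44 u + 4 s <= 37 m^2], which uses that [s] becomes denser under deletion,
    is preserved, and at [s = 89/100 m^2] it says [u <= 19/25 m^2]. *)

Set Implicit Arguments.
Unset Strict Implicit.
Unset Printing Implicit Defensive.

(** * Quadratic forms and cliques *)

Definition clique (V : finType) (e : rel V) (X : {set V}) : Prop :=
  {in X &, forall x y, x != y -> e x y}.

Definition support_set (F : realFieldType) (V : finType) (x : V -> F) : {set V} :=
  [set v | x v != 0].

Definition quad (F : realFieldType) (V : finType) (M : V -> V -> F) (L : V -> F)
    (x : V -> F) : F :=
  \sum_a \sum_b M a b * x a * x b + \sum_a L a * x a.

Lemma sum_delta (F : realFieldType) (V : finType) (f : V -> F) (i : V) :
  \sum_b f b * (b == i)%:R = f i.
Proof.
rewrite (bigD1 i) //= eqxx mulr1 big1 ?addr0 // => b /negPf ->.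
by rewrite mulr0.
Qed.

(** Since [M i j = 0], the second-order term vanishes: the form is affine in the
    amount of weight moved from [j] to [i]. *)
Lemma quad_shift (F : realFieldType) (V : finType) (M : V -> V -> F) (L : V -> F)
    (x : V -> F) (i j : V) (t : F) :
  (forall a b, M a b = M b a) -> M i i = 0 -> M j j = 0 -> M i j = 0 ->
  quad M L (fun v => x v + t * ((v == i)%:R - (v == j)%:R)) =
  quad M L x + t * (2 * (\sum_b M i b * x b) - 2 * (\sum_b M j b * x b)
                    + L i - L j).
Proof.
move=> Msym Mii Mjj Mij.
pose d v : F := (v == i)%:R - (v == j)%:R.
have sumd f : \sum_b f b * d b = f i - f j.
  under eq_bigr do rewrite /d mulrBr.
  by rewrite sumrB !sum_delta.
have row a : \sum_b M a b * (x a + t * d a) * (x b + t * d b) =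
    \sum_b M a b * x a * x b + t * ((\sum_b M a b * x b) * d a)
    + t * (x a * (M i a - M j a)) + t ^+ 2 * ((M a i - M a j) * d a).
  have -> : x a * (M i a - M j a) = \sum_b x a * M a b * d b.
    by rewrite sumd !(Msym a) mulrBr.
  rewrite -sumd !mulr_suml !mulr_sumr -!big_split /=.
  by apply: eq_bigr => b _; ring.
rewrite /quad -/d; under eq_bigr do rewrite row.
under [X in _ + X]eq_bigr do rewrite mulrDr mulrCA.
rewrite !big_split /= -!mulr_sumr !sumd.
have -> : \sum_a x a * (M i a - M j a) = \sum_b M i b * x b - \sum_b M j b * x b.
  by rewrite -sumrB; apply: eq_bigr => b _; ring.
rewrite Mii Mjj (Msym j i) Mij; ring.
Qed.

(** Motzkin-Straus.  On a pair outside [e] the form is affine in the weight moved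
    from one vertex to the other, so one of the two can be emptied without
    decreasing it; this can be repeated until the support is a clique. *)
Lemma clique_weights (F : realFieldType) (V : finType) (e : rel V)
    (M : V -> V -> F) (L : V -> F) (x : V -> F) :
  irreflexive e -> (forall a b, M a b = M b a) ->
  (forall a b, ~~ e a b -> M a b = 0) -> (forall v, 0 <= x v) ->
  exists y : V -> F,
    [/\ forall v, 0 <= y v, \sum_v y v = \sum_v x v,
        support_set y \subset support_set x, clique e (support_set y)
      & quad M L x <= quad M L y].
Proof.
move=> eirr Msym M0; have [n] := ubnP #|support_set x|.
elim: n x => // n IHn x lexn x0.
have Mvv v : M v v = 0 by rewrite M0 ?eirr.
case: (boolP [exists i in support_set x, exists j in support_set x,
              (i != j) && ~~ e i j]); last first.
  move=> /exists_inPn noij; exists x; split=> // i j iX jX nij.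
  by have /exists_inPn/(_ j jX) := noij i iX; rewrite nij /= negbK.
case/exists_inP=> i iX /exists_inP[j jX /andP[nij neij]].
have Mij := M0 _ _ neij.
have [xi0 xj0] : x i != 0 /\ x j != 0 by move: iX jX; rewrite !inE.
pose slope := 2 * (\sum_b M i b * x b) - 2 * (\sum_b M j b * x b) + L i - L j.
(* Emptying k into the other vertex l of the pair, in the uphill direction. *)
have [k [l [t [kl kX lX t0 tkl]]]] : exists k l t, [/\ k != l, x k != 0, x l != 0,
    0 <= t * slope & forall v, x v + t * ((v == i)%:R - (v == j)%:R) =
      x v + x k * ((v == l)%:R - (v == k)%:R)].
  have [s0|s0] := leP 0 slope.
    by exists j, i, (x j); split; rewrite // 1?eq_sym // mulr_ge0.
  exists i, j, (- x i); split=> // [|v]; last by rewrite mulNr -mulrN opprB.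
  by rewrite mulNr -mulrN mulr_ge0 // oppr_ge0 ltW.
pose y v := x v + t * ((v == i)%:R - (v == j)%:R).
have yk : y k = 0 by rewrite /y tkl eqxx (negPf kl) sub0r mulrN1 subrr.
have y0 v : 0 <= y v.
  have [->|nvk] := eqVneq v k; first by rewrite yk.
  by rewrite /y tkl (negPf nvk) subr0 addr_ge0 ?mulr_ge0.
have sy : \sum_v y v = \sum_v x v.
  have sum1 w : \sum_v (v == w)%:R = 1 :> F.
    by have := sum_delta (fun=> 1 : F) w; under eq_bigr do rewrite mul1r.
  by rewrite big_split -mulr_sumr sumrB /= !sum1 subrr mulr0 addr0.
have subyx : support_set y \subset support_set x :\ k.
  apply/subsetP=> v; rewrite !inE => yv0.
  have nvk : v != k by apply: contraNneq yv0 => ->; rewrite yk.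
  rewrite nvk /=; apply: contraNneq yv0 => xv0.
  rewrite /y tkl xv0 (negPf nvk).
  by have [vl|] := eqVneq v l; [rewrite -vl xv0 eqxx in lX | rewrite subr0 mulr0 addr0].
have lty : (#|support_set y| < n)%N.
  apply: leq_ltn_trans (subset_leq_card subyx) _.
  by move: lexn; rewrite (cardsD1 k) inE kX.
have [z [z0 sz subzy cz lez]] := IHn y lty y0.
exists z; split; rewrite // ?sz //.
  by apply: subset_trans subzy (subset_trans subyx _); apply: subsetDl.
by apply: le_trans lez; rewrite quad_shift // lerDl.
Qed.

(** Cauchy-Schwarz against the constant 1 on the support. *)
Lemma sum_sqr_ge (F : realFieldType) (V : finType) (y : V -> F) (X : {set V}) :
  \sum_(v in X) y v = 1 -> 1 <= #|X|%:R * \sum_(v in X) y v ^+ 2.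
Proof.
move=> sy; have [X0|X0] := posnP #|X|.
  by move: sy; rewrite (cards0_eq X0) big_set0 => /esym/eqP; rewrite oner_eq0.
have c0 : 0 < #|X|%:R :> F by rewrite ltr0n.
have : 0 <= \sum_(v in X) (#|X|%:R * y v - 1) ^+ 2.
  by apply: sumr_ge0 => v _; apply: sqr_ge0.
have -> : \sum_(v in X) (#|X|%:R * y v - 1) ^+ 2 =
    #|X|%:R * (#|X|%:R * \sum_(v in X) y v ^+ 2 - 1).
  rewrite (eq_bigr (fun v => #|X|%:R ^+ 2 * y v ^+ 2 - 2 * #|X|%:R * y v + 1));
    last by move=> v _; ring.
  rewrite big_split sumrB /= -!mulr_sumr sy sumr_const; ring.
by rewrite pmulr_rge0 // subr_ge0.
Qed.

(** On a clique every off-diagonal product occurs. *)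
Lemma clique_form (F : realFieldType) (V : finType) (e : rel V) (y : V -> F) :
  irreflexive e -> clique e (support_set y) -> \sum_v y v = 1 ->
  \sum_a \sum_b (e a b)%:R * y a * y b = 1 - \sum_v y v ^+ 2.
Proof.
move=> eirr cy sy.
rewrite -[X in _ = X - _](_ : \sum_a \sum_b y a * y b = 1); last first.
  by rewrite -[RHS]mulr1 -{1}sy -sy mulr_suml; apply: eq_bigr => a _; rewrite mulr_sumr.
rewrite -sumrB; apply: eq_bigr => a _.
rewrite (bigD1 a) //= [in RHS](bigD1 a) //= eirr !mul0r add0r expr2 addrAC subrr add0r.
apply: eq_bigr => b nba.
have [->|a0] := eqVneq (y a) 0; first by rewrite mulr0 !mul0r.
have [->|b0] := eqVneq (y b) 0; first by rewrite !mulr0.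
have -> : e a b by apply: cy; rewrite ?inE // eq_sym.
by rewrite mul1r.
Qed.

Definition pairs (V : finType) (e : rel V) (A C : {set V}) : nat :=
  \sum_(x in A) \sum_(y in C) e x y.

Definition uniform (F : realFieldType) (V : finType) (A : {set V}) (v : V) : F :=
  (v \in A)%:R / #|A|%:R.

Lemma uniform_sum (F : realFieldType) (V : finType) (A : {set V}) (f : V -> F) :
  \sum_v f v * uniform F A v = (\sum_(v in A) f v) / #|A|%:R.
Proof.
rewrite mulr_suml [RHS]big_mkcond /=; apply: eq_bigr => v _.
by rewrite /uniform; case: (v \in A); rewrite ?mul1r ?mul0r ?mulr0.
Qed.

Lemma uniform_form (F : realFieldType) (V : finType) (e : rel V) (A : {set V}) :
  \sum_a \sum_b (e a b)%:R * uniform F A a * uniform F A b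
  = (pairs e A A)%:R / #|A|%:R ^+ 2.
Proof.
under eq_bigr => a _.
  under eq_bigr do rewrite mulrAC.
  rewrite -mulr_suml uniform_sum.
  over.
rewrite uniform_sum -mulr_suml expr2 invfM mulrA /pairs natr_sum.
by congr (_ / _ / _); apply: eq_bigr => a _; rewrite natr_sum.
Qed.

Lemma uniform_sum1 (F : realFieldType) (V : finType) (A : {set V}) :
  (0 < #|A|)%N -> \sum_v uniform F A v = 1.
Proof.
move=> A0; under eq_bigr do rewrite -[uniform _ _ _]mul1r.
by rewrite uniform_sum sumr_const divff // pnatr_eq0 -lt0n.
Qed.

Lemma uniform_ge0 (F : realFieldType) (V : finType) (A : {set V}) v :
  0 <= uniform F A v.
Proof. by rewrite mulr_ge0 ?invr_ge0 ?ler0n. Qed.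

Lemma uniform_support (F : realFieldType) (V : finType) (A : {set V}) :
  support_set (uniform F A) \subset A.
Proof.
apply/subsetP=> v; rewrite inE /uniform; case: (v \in A) => //.
by rewrite mul0r eqxx.
Qed.

Lemma sum_support (F : realFieldType) (V : finType) (y f : V -> F) :
  (forall v, y v = 0 -> f v = 0) -> \sum_v f v = \sum_(v in support_set y) f v.
Proof.
move=> f0; rewrite [RHS]big_mkcond /=; apply: eq_bigr => v _.
by rewrite inE; case: eqP => // /f0.
Qed.

(** Stated without division; for [k = 0] it says that [A] is empty.  On the
    clique reached from the uniform weights the form is [1 - \sum y^2], which is
    at most [1 - 1/k] by Cauchy-Schwarz. *)
Lemma turan (V : finType) (e : rel V) (A : {set V}) (k : nat) :
  symmetric e -> irreflexive e ->
  (forall X : {set V}, X \subset A -> clique e X -> (#|X| <= k)%N) ->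
  (k * pairs e A A + #|A| ^ 2 <= k * #|A| ^ 2)%N.
Proof.
move=> esym eirr clk; have [A0|A0] := posnP #|A|.
  by rewrite (cards0_eq A0) /pairs big_set0 cards0 muln0.
pose M a b : rat := (e a b)%:R.
have [|a b /negPf||y [y0 sy suby cy ley]] := clique_weights (M := M) (fun=> 0)
  (x := uniform rat A) eirr.
- by move=> a b; rewrite /M esym.
- by rewrite /M => ->.
- exact: uniform_ge0.
rewrite uniform_sum1 // in sy.
have lek : (#|support_set y| <= k)%N.
  by apply: clk => //; apply: subset_trans suby (uniform_support _ _).
move: ley; rewrite /quad uniform_form (clique_form eirr cy sy).
have no_linear (z : V -> rat) : \sum_v 0 * z v = 0 by rewrite -mulr_sumr mul0r.
rewrite !no_linear !addr0.
have A0r : 0 < #|A|%:R :> rat by rewrite ltr0n.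
rewrite ler_pdivrMr ?exprn_gt0 // => ley.
have sq : 1 <= k%:R * \sum_v y v ^+ 2.
  rewrite (@sum_support _ _ y) => [|v ->]; last by rewrite expr0n.
  apply: le_trans (ler_wpM2r _ (_ : #|support_set y|%:R <= k%:R)).
  - by apply: sum_sqr_ge; rewrite -(@sum_support _ _ y y).
  - by apply: sumr_ge0 => v _; apply: sqr_ge0.
  - by rewrite ler_nat.
rewrite -(ler_nat rat) natrD !natrM.
have k0 : 0 <= k%:R :> rat by apply: ler0n.
have := ler_wpM2l k0 ley.
have := ler_wpM2r (sqr_ge0 #|A|%:R : 0 <= #|A|%:R ^+ 2 :> rat) sq.
lra.
Qed.

(** * Cliques in the union of two triangle-free graphs *)

Definition nbr (V : finType) (H : sgraph V) (v : V) : {set V} := [set x | adj H v x].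

Lemma triangle_free_clique (V : finType) (H : sgraph V) (X : {set V}) :
  triangle_free H -> clique (adj H) X -> (#|X| <= 2)%N.
Proof.
move=> Hfree cX; rewrite leqNgt.
apply/negP=> /card_gt2P[x [y [z [[xX yX zX] [xy yz zx]]]]].
by apply: (Hfree x y z); split; apply: cX => //; rewrite eq_sym.
Qed.

Lemma clique_gunionC (V : finType) (G H : sgraph V) (X : {set V}) :
  clique (adj (gunion G H)) X -> clique (adj (gunion H G)) X.
Proof. by move=> cX x y xX yX /(cX x y xX yX); rewrite /= /union_adj orbC. Qed.

Lemma cliqueS (V : finType) (e : rel V) (X Y : {set V}) :
  X \subset Y -> clique e Y -> clique e X.
Proof. by move=> /subsetP sXY cY x y /sXY xY /sXY; apply: cY. Qed.

(** Neighbours of [v] in [G] are pairwise non-adjacent in [G], hence form an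
    [H]-clique inside [Q]. *)
Lemma card_nbr_clique (V : finType) (G H : sgraph V) (Q : {set V}) (v : V) :
  triangle_free G -> triangle_free H -> clique (adj (gunion G H)) Q ->
  (#|nbr G v :&: Q| <= 2)%N.
Proof.
move=> Gfree Hfree /(cliqueS (subsetIr (nbr G v) Q)) cX.
apply: (triangle_free_clique Hfree) => x y xX yX nxy.
have /orP[Gxy|//] : adj G x y || adj H x y := cX x y xX yX nxy.
move: xX yX; rewrite !inE => /andP[vx _] /andP[vy _].
by case: (Gfree v x y).
Qed.

(** Whatever the colour of an edge between two such vertices, it closes a
    triangle with [v] or with [w].  For [v = w] this says that the bicoloured
    edges of a clique form a matching. *)
Lemma card_cross_nbr_clique (V : finType) (G H : sgraph V) (Q : {set V}) (v w : V) :
  triangle_free G -> triangle_free H -> clique (adj (gunion G H)) Q ->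
  (#|nbr G v :&: nbr H w :&: Q| <= 1)%N.
Proof.
move=> Gfree Hfree cQ; rewrite leqNgt; apply/negP=> /card_gt1P[x [y [+ + nxy]]].
rewrite !inE => /andP[/andP[vx wx] xQ] /andP[/andP[vy wy] yQ].
have /orP[xy|xy] : adj G x y || adj H x y := cQ x y xQ yQ nxy.
- by case: (Gfree v x y).
- by case: (Hfree w x y).
Qed.

Lemma sum_mem_card (V : finType) (S Q : {set V}) :
  (\sum_(x in Q) (x \in S) = #|S :&: Q|)%N.
Proof.
rewrite -sum1_card big_mkcond [RHS]big_mkcond /=; apply: eq_bigr => x _.
by rewrite inE andbC; case: (x \in Q); case: (x \in S).
Qed.

Section TwoColours.

Variables (V : finType) (R B : sgraph V).
Hypotheses (Rfree : triangle_free R) (Bfree : triangle_free B).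

Local Notation U := (adj (gunion R B)).

Definition bicoloured : rel V := fun x y => adj R x y && adj B x y.

Lemma nbr_gunion v : nbr (gunion R B) v = nbr R v :|: nbr B v.
Proof. by apply/setP=> x; rewrite !inE. Qed.

Lemma card_colour_nbrs (Q : {set V}) v : clique U Q ->
  (#|nbr R v :&: Q| + #|nbr B v :&: Q| <= 4)%N.
Proof.
move=> cQ; rewrite (_ : 4 = 2 + 2)%N // leq_add //.
  exact: card_nbr_clique Rfree Bfree cQ.
exact: card_nbr_clique Bfree Rfree (clique_gunionC cQ).
Qed.

Lemma card_gunion_nbrs (Q : {set V}) v : clique U Q ->
  (#|nbr (gunion R B) v :&: Q| <= 4)%N.
Proof.
move=> /(card_colour_nbrs v); apply: leq_trans.
by rewrite nbr_gunion setIUl leq_card_setU.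
Qed.

Lemma clique_card_le5 (Q : {set V}) : clique U Q -> (#|Q| <= 5)%N.
Proof.
move=> cQ; have [->|[v vQ]] := set_0Vmem Q; first by rewrite cards0.
rewrite (cardsD1 v) vQ (_ : 5 = 1 + 4)%N // leq_add2l.
apply: leq_trans (card_gunion_nbrs v cQ); apply/subset_leq_card/subsetP=> x.
rewrite in_setD1 inE => /andP[nxv xQ]; rewrite xQ andbT inE.
by apply: cQ; rewrite // eq_sym.
Qed.

(** A common neighbour sees [v] and [w] in different colours only, and each of the
    two colour patterns occurs at most once. *)
Lemma bicoloured_common_nbrs (Q : {set V}) v w : clique U Q -> bicoloured v w ->
  (#|nbr (gunion R B) v :&: nbr (gunion R B) w :&: Q| <= 2)%N.
Proof.
move=> cQ /andP[Rvw Bvw].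
apply: (@leq_trans #|(nbr R v :&: nbr B w :&: Q) :|: (nbr B v :&: nbr R w :&: Q)|).
  apply/subset_leq_card/subsetP=> x; rewrite !inE /= /union_adj.
  case/andP=> /andP[vx wx] ->; rewrite !andbT.
  case Rvx: (adj R v x) vx => /=; case Rwx: (adj R w x) wx => //=.
  - by case: (@Rfree v w x).
  - by move=> ->.
  - by move=> _ ->.
  - by move=> Bwx Bvx; case: (@Bfree v w x).
apply: leq_trans (leq_card_setU _ _) _; rewrite (_ : 2 = 1 + 1)%N // leq_add //.
  exact: card_cross_nbr_clique Rfree Bfree cQ.
exact: card_cross_nbr_clique Bfree Rfree (clique_gunionC cQ).
Qed.

Definition full (Q : {set V}) : {set V} :=
  [set v | #|nbr (gunion R B) v :&: Q| == 4].

(** Two sets of four vertices among at most five share at least three. *)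
Lemma full_no_bicoloured (Q : {set V}) v w : clique U Q ->
  v \in full Q -> w \in full Q -> ~~ bicoloured v w.
Proof.
move=> cQ; rewrite !inE => /eqP v4 /eqP w4; apply/negP=> /(bicoloured_common_nbrs cQ).
have := clique_card_le5 cQ.
have := cardsUI (nbr (gunion R B) v :&: Q) (nbr (gunion R B) w :&: Q).
rewrite -setIIl -setIUl v4 w4 => e Q5.
have : (#|(nbr (gunion R B) v :|: nbr (gunion R B) w) :&: Q| <= #|Q|)%N.
  by apply/subset_leq_card/subsetIr.
lia.
Qed.

Lemma bicoloured_sym : symmetric bicoloured.
Proof. by move=> x y; rewrite /bicoloured adj_sym [adj B x y]adj_sym. Qed.

(** With [X] the support, [q] the sum of the squared weights and [D] the
    contribution of the bicoloured edges, the form is [1 - q + D]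
    plus [14/25] of the weight of [W].  If [X] has no bicoloured edge then [D = 0]
    and [q >= 1/5], which gives [4/5 + 14/25 = 34/25].  Otherwise a vertex off
    the bicoloured matching contributes to the excess over [1 + 7/25] at most
    [t * 7/25 - t^2 <= 49/2500], and an edge of the matching, of which at most
    one end lies in [W], contributes at most the same amount.  There are at most
    five vertices and at least one matching edge, hence at most four such
    contributions, and [1 + 7/25 + 4 * 49/2500 < 34/25]. *)
Lemma sparse_weights (F : realFieldType) (W : {set V}) (y : V -> F) :
  {in W &, forall v w, ~~ bicoloured v w} ->
  (forall v, 0 <= y v) -> \sum_v y v = 1 -> clique U (support_set y) ->
  \sum_a \sum_b ((adj R a b)%:R + (adj B a b)%:R) * y a * y b
    + \sum_v (14 / 25 * (v \in W)%:R) * y v <= 34 / 25.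
Proof.
move=> Wd y0 sy cX; set X := support_set y in cX.
have X5 : #|X|%:R <= 5 :> F by rewrite ler_nat clique_card_le5.
have -> : \sum_a \sum_b ((adj R a b)%:R + (adj B a b)%:R) * y a * y b =
    1 - \sum_v y v ^+ 2 + \sum_a \sum_b (bicoloured a b)%:R * y a * y b.
  rewrite -(clique_form (@adj_irr _ _) cX sy) -big_split; apply: eq_bigr => a _.
  rewrite -big_split; apply: eq_bigr => b _ /=.
  by rewrite /union_adj /bicoloured; case: (adj R a b); case: (adj B a b) => /=; ring.
have X0 (f : V -> F) : (forall v, y v = 0 -> f v = 0) -> \sum_v f v = \sum_(v in X) f v.
  exact: sum_support.
rewrite (X0 (fun v => y v ^+ 2)) => [|v ->]; last by rewrite expr0n.
rewrite (X0 (fun v => _ * y v)) => [|v ->]; last by rewrite mulr0.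
have -> : \sum_a \sum_b (bicoloured a b)%:R * y a * y b =
    \sum_(a in X) \sum_(b in X) (bicoloured a b)%:R * y a * y b.
  rewrite X0 => [|v yv]; last by rewrite big1 // => b _; rewrite yv mulr0 mul0r.
  by apply: eq_bigr => a _; rewrite X0 // => v ->; rewrite mulr0.
have sX : \sum_(v in X) y v = 1 by rewrite -X0.
case: (boolP [exists a in X, exists b in X, bicoloured a b]); last first.
  move=> /exists_inPn noD.
  have -> : \sum_(a in X) \sum_(b in X) (bicoloured a b)%:R * y a * y b = 0.
    rewrite big1 // => a aX; have /exists_inPn noDa := noD a aX.
    by rewrite big1 // => b /noDa /negPf ->; rewrite !mul0r.
  have lW : \sum_(v in X) 14 / 25 * (v \in W)%:R * y v <=
      14 / 25 * \sum_(v in X) y v.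
    rewrite mulr_sumr; apply: ler_sum => v _.
    by have := y0 v; case: (v \in W) => /=; lra.
  have q0 : 0 <= \sum_(v in X) y v ^+ 2 by apply: sumr_ge0 => v _; apply: sqr_ge0.
  have := sum_sqr_ge sX; rewrite sX in lW.
  have := ler_wpM2r q0 X5.
  lra.
case/exists_inP=> a0 a0X /exists_inP[b0 b0X Dab].
(* Signs record membership in W: the weight of W is half of the total weight
   plus half of the signed sum. *)
pose eps v : F := if v \in W then 1 else -1.
pose n a : F := \sum_(b in X) (bicoloured a b)%:R.
have n1 a : n a <= 1.
  have := card_cross_nbr_clique a a Rfree Bfree cX.
  rewrite -sum_mem_card -(ler_nat F) natr_sum; apply: le_trans.
  by rewrite le_eqVlt; apply/orP; left; apply/eqP/eq_bigr => b _; rewrite !inE.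
have n0 a : 0 <= n a by apply: sumr_ge0 => b _; apply: ler0n.
have npair : 2 <= \sum_(a in X) n a.
  have nge1 a b : a \in X -> b \in X -> bicoloured a b -> 1 <= n a.
    move=> aX bX ab; rewrite /n (bigD1 b bX) /= ab lerDl.
    by apply: sumr_ge0 => c _; apply: ler0n.
  have na0b0 : b0 != a0.
    by apply: contraTneq Dab => ->; rewrite /bicoloured adj_irr.
  rewrite (bigD1 a0) //= (bigD1 b0) ?b0X //=.
  have := nge1 _ _ a0X b0X Dab.
  rewrite bicoloured_sym in Dab; have := nge1 _ _ b0X a0X Dab.
  have rest : 0 <= \sum_(a | (a \in X) && (a != a0) && (a != b0)) n a.
    by apply: sumr_ge0.
  lra.
pose h a b : F := 7 / 25 * eps a * y a - y a ^+ 2 + y a * y b.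
(* With [d] the difference of the two weights, the two ends together amount to
   at most [7/25 d - d^2]. *)
have hpair a b : a \in X -> b \in X ->
    (bicoloured a b)%:R * (h a b + h b a) <= (bicoloured a b)%:R * (49 / 2500).
  move=> aX bX; case Dab': (bicoloured a b); last by rewrite !mul0r.
  rewrite !mul1r /h /eps.
  have := y0 a; have := y0 b.
  have [aW|_] := boolP (a \in W); have [bW|_] := boolP (b \in W).
  - by have := Wd a b aW bW; rewrite Dab'.
  - have := sqr_ge0 (y a - y b - 7 / 50); nra.
  - have := sqr_ge0 (y b - y a - 7 / 50); nra.
  - have := sqr_ge0 (y a - y b); nra.
(* A matching edge is met once from each end, so each end is charged half of
   [49/2500]. *)
have hsum : \sum_(a in X) \sum_(b in X) (bicoloured a b)%:R * h a b <=
    49 / 5000 * \sum_(a in X) n a.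
  have swap : \sum_(a in X) \sum_(b in X) (bicoloured a b)%:R * h a b =
      \sum_(a in X) \sum_(b in X) (bicoloured a b)%:R * h b a.
    rewrite exchange_big; apply: eq_bigr => a _; apply: eq_bigr => b _.
    by rewrite bicoloured_sym.
  have : \sum_(a in X) \sum_(b in X) (bicoloured a b)%:R * (h a b + h b a) <=
      \sum_(a in X) \sum_(b in X) (bicoloured a b)%:R * (49 / 2500).
    by apply: ler_sum => a aX; apply: ler_sum => b bX; apply: hpair.
  under eq_bigr do under eq_bigr do rewrite mulrDr.
  under eq_bigr do rewrite big_split.
  rewrite big_split /= -swap.
  under [X in _ <= X -> _]eq_bigr do rewrite -mulr_suml.
  rewrite -mulr_suml -/n; lra.
have vertex a : a \in X ->
    7 / 25 * eps a * y a - y a ^+ 2 + \sum_(b in X) (bicoloured a b)%:R * y a * y b <=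
    49 / 2500 * (1 - n a) + \sum_(b in X) (bicoloured a b)%:R * h a b.
  move=> aX; set e := _ - y a ^+ 2.
  have -> : \sum_(b in X) (bicoloured a b)%:R * h a b =
      n a * e + \sum_(b in X) (bicoloured a b)%:R * y a * y b.
    by rewrite mulr_suml -big_split; apply: eq_bigr => b _; rewrite /h /e /=; ring.
  have ec : e <= 49 / 2500.
    have := y0 a; have := sqr_ge0 (y a - 7 / 50).
    by rewrite /e /eps; case: (a \in W); nra.
  have : 0 <= (1 - n a) * (49 / 2500 - e) by rewrite mulr_ge0 ?subr_ge0.
  lra.
have : \sum_(a in X) (7 / 25 * eps a * y a - y a ^+ 2
        + \sum_(b in X) (bicoloured a b)%:R * y a * y b) <=
    \sum_(a in X) (49 / 2500 * (1 - n a)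
        + \sum_(b in X) (bicoloured a b)%:R * h a b).
  exact: ler_sum.
rewrite !big_split /= sumrN -mulr_sumr sumrB sumr_const => vsum.
have epsE : \sum_(v in X) 14 / 25 * (v \in W)%:R * y v =
    7 / 25 + \sum_(v in X) 7 / 25 * eps v * y v.
  rewrite -[X in _ = X + _]mulr1 -[X in _ = _ * X + _]sX mulr_sumr -big_split.
  apply: eq_bigr => v _ /=.
  by rewrite /eps; case: (v \in W) => /=; field.
rewrite epsE; lra.
Qed.

End TwoColours.

(** * Counting ordered pairs *)

Lemma pairsC (V : finType) (e : rel V) (A C : {set V}) :
  symmetric e -> pairs e A C = pairs e C A.
Proof.
move=> esym; rewrite /pairs exchange_big; apply: eq_bigr => x _.
by apply: eq_bigr => y _; rewrite esym.
Qed.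

Lemma pairs_splitl (V : finType) (e : rel V) (A C Q : {set V}) : Q \subset A ->
  pairs e A C = (pairs e Q C + pairs e (A :\: Q) C)%N.
Proof. by move=> /setIidPr QA; rewrite /pairs (big_setID Q) /= QA. Qed.

Lemma pairs_remove (V : finType) (e : rel V) (A Q : {set V}) :
  symmetric e -> Q \subset A ->
  (pairs e A A + pairs e Q Q = pairs e (A :\: Q) (A :\: Q) + 2 * pairs e A Q)%N.
Proof.
move=> esym QA; have := pairs_splitl e A QA; have := pairs_splitl e (A :\: Q) QA.
have := pairs_splitl e Q QA; rewrite (pairsC A (A :\: Q) esym) (pairsC Q A esym).
rewrite (pairsC Q (A :\: Q) esym).
lia.
Qed.

Lemma pairs_nbr (V : finType) (H : sgraph V) (A Q : {set V}) :
  pairs (adj H) A Q = (\sum_(x in A) #|nbr H x :&: Q|)%N.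
Proof.
apply: eq_bigr => x _; rewrite -sum_mem_card.
by apply: eq_bigr => y _; rewrite inE.
Qed.

Lemma pairs_clique (V : finType) (H : sgraph V) (Q : {set V}) :
  clique (adj H) Q -> (pairs (adj H) Q Q + #|Q| = #|Q| ^ 2)%N.
Proof.
move=> cQ; rewrite -mulnn -sum_nat_const -[X in (_ + X)%N]sum1_card -big_split /=.
apply: eq_bigr => x xQ; rewrite [RHS](cardsD1 x) xQ addnC; congr (_ + _)%N.
rewrite (bigD1 x) //= adj_irr add0n -sum1_card.
apply: eq_big => y; first by rewrite in_setD1 andbC.
by move=> /andP[yQ nyx]; rewrite cQ // eq_sym.
Qed.

Section TwoColours.

Variables (V : finType) (R B : sgraph V).
Hypotheses (Rfree : triangle_free R) (Bfree : triangle_free B).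

Local Notation U := (adj (gunion R B)).

Definition union_pairs (A : {set V}) : nat := pairs U A A.
Definition colour_pairs (A : {set V}) : nat :=
  (pairs (adj R) A A + pairs (adj B) A A)%N.

(** The case of uniform weights on [A] of the weighted inequality. *)
Lemma sparse_pairs (A W : {set V}) : W \subset A ->
  {in W &, forall v w, ~~ bicoloured R B v w} ->
  (25 * colour_pairs A + 14 * #|A| * #|W| <= 34 * #|A| ^ 2)%N.
Proof.
move=> WA Wd; have [A0|A0] := posnP #|A|.
  by move: WA; rewrite (cards0_eq A0) /colour_pairs /pairs !big_set0 cards0.
pose M a b : rat := (adj R a b)%:R + (adj B a b)%:R.
pose L v : rat := 14 / 25 * (v \in W)%:R.
have [|a b||y [y0 sy _ cy ley]] := clique_weights (M := M) L
  (x := uniform rat A) (@adj_irr _ (gunion R B)).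
- by move=> a b; rewrite /M adj_sym [adj B a b]adj_sym.
- by rewrite /M /= /union_adj negb_or => /andP[/negPf -> /negPf ->]; rewrite addr0.
- exact: uniform_ge0.
rewrite uniform_sum1 // in sy.
have {ley} := le_trans ley (sparse_weights Rfree Bfree Wd y0 sy cy).
have A0r : 0 < #|A|%:R :> rat by rewrite ltr0n.
rewrite /quad uniform_sum.
under eq_bigr do under eq_bigr do rewrite /M !mulrDl.
under eq_bigr do rewrite big_split /=.
rewrite big_split /= !uniform_form -mulrDl -natrD -/(colour_pairs A).
rewrite -mulr_sumr -natr_sum sum_mem_card (setIidPl WA) => le34.
rewrite -(ler_nat rat) natrD !natrM.
have clear_denoms (c w : rat) : (c / #|A|%:R ^+ 2 + 14 / 25 * w / #|A|%:R) *
    #|A|%:R ^+ 2 = c + 14 / 25 * w * #|A|%:R.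
  by field; rewrite gt_eqF.
have := ler_wpM2r (sqr_ge0 (#|A|%:R : rat)) le34.
rewrite clear_denoms.
lra.
Qed.

(** The witness [w] is the number of vertices of [A] with four neighbours in [Q];
    all the others have at most three.  The two summands [20] are the ordered
    pairs inside [Q], which are counted twice when its vertices are deleted. *)
Lemma clique_removal (A Q : {set V}) : Q \subset A -> #|Q| = 5%N -> clique U Q ->
  exists w : nat,
  [/\ (#|A| = #|A :\: Q| + 5)%N,
      (colour_pairs A + 20 <= colour_pairs (A :\: Q) + 8 * #|A|)%N,
      (union_pairs A + 20 <= union_pairs (A :\: Q) + 6 * #|A| + 2 * w)%N
    & (25 * colour_pairs A + 14 * #|A| * w <= 34 * #|A| ^ 2)%N].
Proof.
move=> QA Q5 cQ.
have cardA : #|A| = (#|A :\: Q| + 5)%N.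
  by rewrite -(cardsID Q A) (setIidPr QA) Q5 addnC.
have unionQ : pairs U Q Q = 20%N by have := pairs_clique cQ; rewrite Q5; lia.
have colQ : (20 <= pairs (adj R) Q Q + pairs (adj B) Q Q)%N.
  rewrite -unionQ /pairs -big_split /=; apply: leq_sum => x _.
  rewrite -big_split /=; apply: leq_sum => y _.
  by rewrite /union_adj; case: (adj R x y); case: (adj B x y).
have colA : (pairs (adj R) A Q + pairs (adj B) A Q <= 4 * #|A|)%N.
  rewrite !pairs_nbr -big_split /= mulnC -sum_nat_const.
  by apply: leq_sum => x _; apply: card_colour_nbrs.
have unionA : (pairs U A Q <= 3 * #|A| + #|full R B Q :&: A|)%N.
  rewrite pairs_nbr mulnC -sum_nat_const -sum_mem_card -big_split /=.
  apply: leq_sum => x _; have := card_gunion_nbrs Rfree Bfree x cQ.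
  by rewrite inE; case: eqP => [->//|]; lia.
exists #|full R B Q :&: A|; split.
- by rewrite cardA.
- have := pairs_remove (@adj_sym _ R) QA; have := pairs_remove (@adj_sym _ B) QA.
  rewrite /colour_pairs; move: colQ colA; lia.
- have := pairs_remove (@adj_sym _ (gunion R B)) QA.
  rewrite /union_pairs; move: unionQ unionA; lia.
- apply: sparse_pairs; first exact: subsetIr.
  by move=> v w /setIP[vF _] /setIP[wF _]; apply: full_no_bicoloured vF wF.
Qed.

(** Induction by deleting 5-cliques of the union until none is left.  What the
    rest of the argument needs to know of the graphs is expressed by arithmetic
    relations between the three counts. *)
Lemma union_pairs_ind (P : nat -> nat -> nat -> Prop) :
  (forall m u s, 4 * u <= 3 * m ^ 2 -> s <= m ^ 2 -> P m u s)%N ->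
  (forall m u s m' u' s' w, P m' u' s' ->
     m = m' + 5 -> s + 20 <= s' + 8 * m -> u + 20 <= u' + 6 * m + 2 * w ->
     25 * s + 14 * m * w <= 34 * m ^ 2 -> P m u s)%N ->
  forall A : {set V}, P #|A| (union_pairs A) (colour_pairs A).
Proof.
move=> base step A; have [n] := ubnP #|A|; elim: n A => // n IHn A ltAn.
case: (boolP [exists Q : {set V}, [&& Q \subset A, #|Q| == 5 &
    [forall x in Q, forall y in Q, (x != y) ==> U x y]]]).
  case/existsP=> Q /and3P[QA /eqP Q5 /forall_inP cQ].
  have cQ' : clique U Q.
    by move=> x y xQ yQ; have /forall_inP/(_ y yQ)/implyP := cQ x xQ.
  have [w [cardA sA uA sparse]] := clique_removal QA Q5 cQ'.
  have ltA : (#|A :\: Q| < n)%N by lia.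
  exact: step (IHn _ ltA) cardA sA uA sparse.
move=> /existsPn noQ; apply: base.
  have le4 (X : {set V}) : X \subset A -> clique U X -> (#|X| <= 4)%N.
    move=> XA cX; have X5 := clique_card_le5 Rfree Bfree cX.
    rewrite -ltnS ltn_neqAle X5 andbT; apply: contra (noQ X) => XX.
    rewrite XA XX; apply/forall_inP=> x xX; apply/forall_inP=> y yX.
    by apply/implyP; apply: cX.
  have := turan (@adj_sym _ _) (@adj_irr _ _) le4; rewrite /union_pairs; lia.
have mantel H : triangle_free H -> (2 * pairs (adj H) A A <= #|A| ^ 2)%N.
  move=> Hfree; have := turan (@adj_sym _ H) (@adj_irr _ H) (k := 2)
    (fun X _ => triangle_free_clique Hfree) (A := A).
  lia.
have := mantel R Rfree; have := mantel B Bfree; rewrite /colour_pairs; lia.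
Qed.

(** The inequality proved interpolates linearly between [(s, u) = (1, 3/4)], where
    deletion may end, and [(89/100, 19/25)]. *)
Lemma union_pairs_of_89_100 (A : {set V}) :
  (89 * #|A| ^ 2 <= 100 * colour_pairs A ->
   44 * union_pairs A + 4 * colour_pairs A <= 37 * #|A| ^ 2)%N.
Proof.
apply: (union_pairs_ind (P := fun m u s =>
  89 * m ^ 2 <= 100 * s -> 44 * u + 4 * s <= 37 * m ^ 2)%N) => [m u s|]; first lia.
move=> m u s m' u' s' w IH def_m s20 u20 sparse s89.
have m0 : (0 < m)%N by lia.
(* From [25 * 89/100 = 89/4] and [34 - 89/4 = 47/4]. *)
have w56 : (56 * w <= 47 * m)%N by rewrite -(leq_pmul2l m0); nia.
have /IH : (89 * m' ^ 2 <= 100 * s')%N by nia.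
nia.
Qed.

Lemma union_pairs_of_19_20 (A : {set V}) :
  (19 * #|A| ^ 2 <= 20 * colour_pairs A -> 4 * union_pairs A <= 3 * #|A| ^ 2)%N.
Proof.
apply: (union_pairs_ind (P := fun m u s =>
  19 * m ^ 2 <= 20 * s -> 4 * u <= 3 * m ^ 2)%N) => [m u s|]; first lia.
move=> m u s m' u' s' w IH def_m s20 u20 sparse s19.
have m0 : (0 < m)%N by lia.
have w4 : (4 * w <= 3 * m)%N by rewrite -(leq_pmul2l m0); nia.
have /IH : (19 * m' ^ 2 <= 20 * s')%N by nia.
nia.
Qed.

End TwoColours.

(** * From ordered pairs to edges *)

(** Each edge is the image of exactly two ordered pairs. *)
Lemma card_edges (V : finType) (H : sgraph V) :
  (2 * #|edges H| = pairs (adj H) setT setT)%N.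
Proof.
pose ends (p : V * V) := [set p.1; p.2].
have -> : pairs (adj H) setT setT = (\sum_(p : V * V | adj H p.1 p.2) 1)%N.
  transitivity (\sum_x \sum_y (adj H x y : nat))%N.
    apply: eq_big => [x|x _]; first by rewrite inE.
    by apply: eq_bigl => y; rewrite inE.
  rewrite pair_big /= [RHS]big_mkcond; apply: eq_bigr => p _ /=.
  by case: (adj H _ _).
rewrite (partition_big ends (mem (edges H))) /=; last first.
  by move=> p pH; apply: imset_f; rewrite inE.
rewrite mulnC -sum_nat_const; apply: eq_bigr => E /imsetP[[a b]].
rewrite inE /= => ab ->; have nab : a != b by apply: contraTneq ab => ->; rewrite adj_irr.
rewrite sum1_card -[LHS](_ : #|[set (a, b); (b, a)]| = 2)%N; last first.
  by rewrite cards2 xpair_eqE (negPf nab).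
apply: eq_card => -[c d]; rewrite !inE /= /ends !xpair_eqE unfold_in /=.
apply/idP/idP => [/orP[]/andP[/eqP-> /eqP->]|/andP[cd /eqP cdE]].
- by rewrite ab eqxx.
- by rewrite adj_sym ab setUC eqxx.
have : c \in [set a; b] by rewrite -cdE set21.
have : d \in [set a; b] by rewrite -cdE set22.
have ncd : c != d by apply: contraTneq cd => ->; rewrite adj_irr.
rewrite !inE => /orP[]/eqP dE /orP[]/eqP cE; move: ncd; rewrite cE dE ?eqxx //.
- by rewrite orbT.
Qed.

Unset Implicit Arguments.
Set Printing Implicit Defensive.

Theorem lemma3p3 (K : realType) (a b : K)
  (hab : (a, b) = (19 / 25, 89 / 100) \/ (a, b) = (3 / 4, 19 / 20)) :
  forall eps : K, 0 < eps ->
  exists n0 : nat, forall n : nat, (n0 <= n)%N ->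
  forall (V : finType) (R B : sgraph V), #|V| = n ->
    triangle_free R -> triangle_free B ->
    #|edges R|%:R + #|edges B|%:R >= b * n%:R ^+ 2 / 2 ->
    #|edges (gunion R B)|%:R <= a * n%:R ^+ 2 / 2 + eps * n%:R ^+ 2.
Proof.
move=> eps eps0; exists 0%N => n _ V R B Vn Rfree Bfree hb.
have epsn : 0 <= eps * n%:R ^+ 2 by apply: mulr_ge0; [apply: ltW | apply: sqr_ge0].
suff bound : #|edges (gunion R B)|%:R <= a * n%:R ^+ 2 / 2.
  by rewrite (le_trans bound) // lerDl.
have cU := card_edges (gunion R B).
have cS : colour_pairs R B setT = (2 * (#|edges R| + #|edges B|))%N.
  by rewrite /colour_pairs -!card_edges mulnDr.
have le1 := union_pairs_of_89_100 Rfree Bfree (A := setT).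
have le2 := union_pairs_of_19_20 Rfree Bfree (A := setT).
move: le1 le2; rewrite /union_pairs -cU cS cardsT Vn.
rewrite -!(ler_nat K) !(natrM, natrD) => le1 le2.
case: hab hb => -[-> ->] hb.
- have := le1 _; lra.
- have := le2 _; lra.
Qed.
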